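(* Let $n\ge 4$ be an even integer. If the group $G_n$ is identified with a subgroup of $\mathrm{Sym}(n+1)$ whose elements fix $n+1$, then $G_n$ is a maximal independent set in $\mathrm{Sym}(n+1)$; that is, $G_n$ is an independent set of $G(\Omega_{n+1})$ and $G_n\cup\{\tau\}$ is not an independent set of $G(\Omega_{n+1})$ for any $\tau\in\mathrm{Sym}(n+1)\setminus G_n$.
   Context: Elements of the symmetric group $\mathrm{Sym}(m)$ are identified with $m\times m$ permutation matrices: $\sigma$ corresponds to the matrix $P$ with $P_{ij}=1$ if $j=\sigma(i)$ and $P_{ij}=0$ otherwise. For each $m$, the Birkhoff polytope graph $G(\Omega_m)$ has vertex set $\mathrm{Sym}(m)$, and $\sigma_1,\sigma_2$ are adjacent iff $\sigma_1^{-1}\sigma_2$ is a single cycle of length $>1$ (exactly one nontrivial cycle in its disjoint cycle decomposition). An independent set is a set of pairwise nonadjacent vertices. For even $n=2k\ge 4$, let $H_n=\{P\oplus P:P\in\mathrm{Sym}(k)\}$ (block diagonal matrices with two equal $k\times k$ permutation matrix blocks), let $K_n$ be the group of matrices $\begin{bmatrix} I_k-D & D\\ D & I_k-D\end{bmatrix}$ with $D$ a $k\times k$ diagonal $0$-$1$ matrix of even trace, and let $G_n=H_nK_n=\{hk:h\in H_n,\ k\in K_n\}$, which is a subgroup of $\mathrm{Sym}(n)$. Equivalently, $G_n$ is the group of all even permutations of $\{1,\dots,n\}$ that preserve the partition of $\{1,\dots,n\}$ into the pairs $\{j,j+k\}$, $1\le j\le k$. *)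

(* Defs.v *)
From HB Require Import structures.
From mathcomp Require Import all_boot all_order all_algebra all_fingroup.

Set Implicit Arguments.
Unset Strict Implicit.
Unset Printing Implicit Defensive.

Import GroupScope GRing.Theory.
Local Open Scope ring_scope.

(* A permutation s : 'S_m is identified with the matrix perm_mx s, whose (i, j) *)
(* entry is 1 iff s i = j; perm_mxM says that products correspond, since the    *)
(* product s * t of 'S_m applies s first.                                       *)

Definition single_cycle (m : nat) (s : 'S_m) : bool :=
  #|[set C in porbits s | (1 < #|C|)%N]| == 1%N.

Definition birkhoff_adj (m : nat) : rel 'S_m :=
  fun s1 s2 => single_cycle (s1^-1 * s2)%g.

Definition independent (m : nat) (S : {set 'S_m}) : bool :=
  [forall s1 in S, forall s2 in S, (s1 != s2) ==> ~~ birkhoff_adj s1 s2].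

Definition Hgrp (k : nat) : {set 'S_(k + k)} :=
  [set s | [exists p : 'S_k,
     perm_mx s == block_mx (perm_mx p) 0 0 (perm_mx p) :> 'M[int]_(k + k)]].

Definition diag01 (k : nat) (d : 'rV[bool]_k) : 'M[int]_k :=
  diag_mx (map_mx (fun b : bool => (nat_of_bool b)%:R) d).

Definition Kgrp (k : nat) : {set 'S_(k + k)} :=
  [set s | [exists d : 'rV[bool]_k,
     (2 %| \tr (diag01 d))%Z &&
     (perm_mx s == block_mx (1%:M - diag01 d) (diag01 d)
                            (diag01 d) (1%:M - diag01 d))]].

Definition Ggrp (k : nat) : {set 'S_(k + k)} := (Hgrp k * Kgrp k)%g.

Definition fix_last (m : nat) (s : 'S_m) : 'S_m.+1 :=
  lift_perm ord_max ord_max s.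

(* Main.v *)
Require Import Defs.
From mathcomp Require Import all_boot all_order all_algebra all_fingroup.

(** Let [phi] be the involution that exchanges [j] and [j + k] and fixes the
    extra last point. [G] is the group of even elements of the centraliser
    ['C[phi]] ([mem_fix_last_Ggrp]); signs are read off from determinants of
    the defining block matrices.

    Independence. Since [G] is a group, no even [s] in ['C[phi]] may be a single
    cycle ([even_cent_not_cycle]). Such a cycle would have odd length; it moves
    some [x], hence also [phi x], so that [phi x = s^i x] for some [i]. Then
    [s^(2i)] fixes [x], and as the length is odd so does [s^i], which is absurd.

    Maximality. For [t] outside [G], an even [g] in ['C[phi]] is needed such that
    [g * t] ([g] acting first) is a single cycle ([coset_cycle]). It is enough to
    find one [g] in ['C[phi]], of any parity, such that [s = g * t] is a single
    cycle, [s x = phi x != x] and [s (phi x) != x]: then [tperm x (phi x) * s]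
    is the same cycle with [phi x] cut out ([is_cycle_mul_tperm]), and one of
    the two multipliers is even. To find [g], start from a multiplier that
    achieves [s x = phi x], and among all further multipliers in ['C[phi]] fixing
    [x] take one that minimises the number of cycles. If some pair lay outside
    the cycle of [x], an element of ['C[phi]] supported on two pairs would merge
    cycles and decrease that number ([exists_big_orbit]); so only the fixed
    point [oo] of [phi] can lie outside, and then it is fixed by [s].

    The start requires [s (phi x)] to be a point other than [x] and [oo].
    This can be arranged unless [t] lies in ['C[phi]] up to the
    transposition of [oo] and [t oo] ([pair_start]); in that exceptional case a
    transposition or a 3-cycle is found directly. *)

Set Implicit Arguments.
Unset Strict Implicit.
Unset Printing Implicit Defensive.
Import GroupScope GRing.Theory.

(** * Cycles of a permutation *)

Section Orbits.
Variable T : finType.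
Implicit Types (s g : {perm T}) (x y z : T) (S : {set T}).

Lemma porbit_sub_closed s S x :
  x \in S -> {in S, forall z, s z \in S} -> porbit s x \subset S.
Proof.
move=> Sx clS; apply/subsetP=> _ /porbitP[i ->].
by elim: i => [|i IHi]; rewrite ?expg0 ?perm1 // expgSr permM clS.
Qed.

Lemma porbit_step s x z : (s z \in porbit s x) = (z \in porbit s x).
Proof.
rewrite porbit_sym -eq_porbit_mem -[s z]/((s ^+ 1) z) porbit_perm.
by rewrite eq_porbit_mem porbit_sym.
Qed.

(** The pointwise form of [single_cycle]: one orbit carries all moved points. *)
Definition is_cycle s : Prop :=
  exists x, s x != x /\ forall y, s y != y -> y \in porbit s x.

Lemma porbit_gt1 s x : (1 < #|porbit s x|) = (s x != x).
Proof.
apply/idP/idP=> [|sx].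
  apply: contraTneq => sx; rewrite -leqNgt -(cards1 x) subset_leq_card //.
  apply: porbit_sub_closed; rewrite ?set11 // => z /set1P->.
  by rewrite sx set11.
rewrite (cardD1 x) porbit_id ltnS; apply/card_gt0P; exists (s x).
by rewrite !inE sx porbit_step porbit_id.
Qed.

Lemma porbits_cycle s x :
    s x != x -> (forall y, s y != y -> y \in porbit s x) ->
  [set C in porbits s | 1 < #|C|] = [set porbit s x].
Proof.
move=> sx orb; apply/setP=> C; rewrite !inE.
apply/andP/eqP=> [[/imsetP[y _ ->]]|->]; last by rewrite imset_f ?porbit_gt1.
by rewrite porbit_gt1 => /orb; rewrite porbit_sym -eq_porbit_mem => /eqP->.
Qed.

Lemma sum_card_porbits s : \sum_(C in porbits s) #|C| = #|T|.
Proof.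
have acts_s : [acts <[s]>, on [set: T] | 'P].
  by apply/actsP=> a _ y; rewrite !inE.
rewrite -cardsT -(acts_sum_card_orbit acts_s).
have -> // : porbits s = orbit 'P <[s]> @: [set: T].
apply/setP=> C; apply/imsetP/imsetP=> -[y _ ->].
all: by exists y; rewrite ?inE ?porbitE.
Qed.

(** The sign of [s] is the parity of [\sum_C (#|C| - 1)] over the orbits [C],
    and trivial orbits contribute nothing. *)
Lemma odd_cycle_length s x :
    s x != x -> (forall y, s y != y -> y \in porbit s x) -> ~~ odd_perm s ->
  odd #|porbit s x|.
Proof.
move=> sx orb; rewrite /odd_perm -(sum_card_porbits s) -[#|porbits s|]sum1_card.
have Cx : porbit s x \in porbits s by apply: imset_f.
rewrite (bigD1 _ Cx) [X in _ (+) odd X](bigD1 _ Cx) !oddD addbACA.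
suff -> : \sum_(C in porbits s | C != porbit s x) #|C|
  = \sum_(C in porbits s | C != porbit s x) 1.
  by rewrite addbb addbF /= addbT negbK.
apply: eq_bigr => C /andP[sC neC].
have := congr1 (fun A : {set {set T}} => C \in A) (porbits_cycle sx orb).
rewrite /= !inE sC (negPf neC) /=.
case/imsetP: sC => y _ ->; have := card_porbit_neq0 s y.
by case: #|_| => [|[|]].
Qed.

(** If [x'] immediately follows [x] in the cycle, precomposing with the
    transposition of the two turns [x'] into a fixed point and otherwise keeps
    the cycle; [s x' != x] ensures that something is left of it. *)
Lemma is_cycle_mul_tperm s x x' :
    (forall y, s y != y -> y \in porbit s x) -> s x = x' -> x != x' ->
    s x' != x ->
  is_cycle (tperm x x' * s).
Proof.
move=> orb sx xx' sx'.
set s1 := _ * s.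
have s1x : s1 x = s x' by rewrite permM tpermL.
have s1x' : s1 x' = x' by rewrite permM tpermR.
have s1D z : z != x -> z != x' -> s1 z = s z.
  by move=> zx zx'; rewrite permM tpermD // eq_sym.
exists x; split=> [|y s1y]; first by rewrite s1x.
have [-> | yx] := eqVneq y x; first exact: porbit_id.
have yx' : y != x' by apply: contraNneq s1y => ->; rewrite s1x'.
have /subsetP/(_ y) : porbit s x \subset x' |: porbit s1 x.
  apply: porbit_sub_closed => [|z]; first by rewrite !inE porbit_id orbT.
  have [-> _ | zx] := eqVneq z x; first by rewrite sx setU11.
  have [-> _ | zx'] := eqVneq z x'.
    by rewrite -s1x !inE porbit_step porbit_id orbT.
  by rewrite !inE (negPf zx') -s1D //= porbit_step => ->; rewrite orbT.
by rewrite !inE (negPf yx'); apply; rewrite orb // -s1D.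
Qed.

Lemma is_cycle_tperm x y : x != y -> is_cycle (tperm x y).
Proof.
move=> xy; exists x; rewrite tpermL eq_sym; split=> // z.
case: tpermP => [->|-> _|_ _ /eqP //]; first by rewrite porbit_id.
by rewrite -{1}(tpermL x y) porbit_step porbit_id.
Qed.

Lemma is_cycle_tperm2 x y z : x != y -> x != z -> y != z ->
  is_cycle (tperm x y * tperm x z).
Proof.
move=> xy xz yz; set s := _ * _.
have sx : s x = y by rewrite permM tpermL tpermD // eq_sym.
have sy : s y = z by rewrite permM tpermR tpermL.
exists x; rewrite sx eq_sym; split=> // u su.
have [->|ux] := eqVneq u x; first exact: porbit_id.
have [->|uy] := eqVneq u y; first by rewrite -sx porbit_step porbit_id.
have [->|uz] := eqVneq u z; first by rewrite -sy -sx !porbit_step porbit_id.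
by move: su; rewrite permM !tpermD ?eqxx // eq_sym.
Qed.

Lemma porbits_merge s x y : x \notin porbit s y ->
  #|porbits s| = #|porbits (tperm x y * s)|.+1.
Proof.
move=> sxy; have := porbits_mul_tperm s x y; rewrite /= sxy.
have -> : x != y by apply: contraNneq sxy => ->; rewrite porbit_id.
by rewrite addn1 addn2 => -[].
Qed.

Lemma porbits_split s x y : x \in porbit s y -> x != y ->
  #|porbits (tperm x y * s)| = #|porbits s|.+1.
Proof.
move=> sxy xy; have := porbits_mul_tperm s x y.
by rewrite /= sxy xy addn0 addn1.
Qed.

(** * Permutations commuting with an involution *)

Section Involution.
Variables (phi : {perm T}).
Hypothesis phiK : involutive phi.

Lemma tperm_pair_cent x : tperm x (phi x) \in 'C[phi].
Proof. by apply/cent1P/commgP/conjg_fixP; rewrite tpermJ phiK tpermC. Qed.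

Lemma tperm_swap_cent x y : phi x != x -> phi y != y ->
    y != x -> y != phi x ->
  tperm (phi x) (phi y) * tperm x y \in 'C[phi].
Proof.
move=> fx fy yx yfx; apply/cent1P/commgP/conjg_fixP.
rewrite conjMg !tpermJ !phiK; apply/commgP/conjg_fixP.
have fyx : phi y != x by apply: contraNneq yfx => <-; rewrite phiK.
by rewrite tpermJ !tpermD // 1?eq_sym // eq_sym.
Qed.

Lemma cent_permE g : g \in 'C[phi] -> forall x, g (phi x) = phi (g x).
Proof. by move/cent1P=> cg x; rewrite -!permM cg. Qed.

Lemma cent_perm_trans x y : phi x != x -> phi y != y ->
  exists2 g, g \in 'C[phi] & g x = y.
Proof.
move=> fx fy; have [-> | yx] := eqVneq y x.
  by exists 1; rewrite ?group1 ?perm1.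
have [-> | yfx] := eqVneq y (phi x); first by exists phi; rewrite ?cent1id.
exists (tperm (phi x) (phi y) * tperm x y); first exact: tperm_swap_cent.
rewrite permM [tperm _ _ x]tpermD ?tpermL //.
by apply: contraNneq yfx => <-; rewrite phiK.
Qed.

(** Minimise the number of orbits of [g * s0] over the [g] in ['C[phi]] that fix
    [x]. At a minimum every orbit is [phi]-invariant, because otherwise some
    [tperm b (phi b)] merges two orbits. If a pair [a, phi a] were left outside
    the orbit [O] of [x], take a pair [b, phi b] in [O] other than [x, phi x]: a
    4-cycle on these two pairs, which lies in ['C[phi]], first splits the orbit
    of [a] into a part with [a] and a part with [phi a], and then merges each
    of them with [O]. That leaves one orbit less. *)
Lemma exists_big_orbit s0 x :
    s0 x = phi x -> phi x != x -> s0 (phi x) != x ->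
    phi (s0 (phi x)) != s0 (phi x) ->
  exists2 g, g \in 'C[phi] & [/\ (g * s0) x = phi x, (g * s0) (phi x) != x
    & forall y, phi y != y -> y \in porbit (g * s0) x].
Proof.
move=> s0x fx s0fx fb0.
pose P g := (g \in 'C[phi]) && (g x == x).
have P1 : P 1 by rewrite /P group1 perm1 eqxx.
case: (arg_minnP (fun g => #|porbits (g * s0)|) P1) => g.
move=> /andP[cg /eqP gx] min_g.
set s := g * s0 in min_g.
have sx : s x = phi x by rewrite permM gx.
have sfxE : s (phi x) = s0 (phi x) by rewrite permM cent_permE ?gx.
have sfx : s (phi x) != x by rewrite sfxE.
have {min_g} min_s h : h \in 'C[phi] -> h x = x ->
    #|porbits s| <= #|porbits (h * s)|.
  move=> ch hx; rewrite mulgA; apply: min_g.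
  by rewrite /P groupM // permM hx gx eqxx.
exists g => //; rewrite -/s; split=> //.
have fxx : x \in porbit s (phi x).
  by rewrite -sx porbit_sym porbit_step porbit_id.
have pair_orb b : b \in porbit s (phi b).
  have [-> // | bx] := eqVneq b x.
  have [-> | bfx] := eqVneq b (phi x); first by rewrite phiK porbit_sym.
  apply: contraT => /porbits_merge merge_b.
  have := min_s _ (tperm_pair_cent b); rewrite merge_b ltnn; apply.
  by rewrite tpermD //; apply: contraNneq bfx => <-; rewrite phiK.
have pair_mem z : z \in porbit s x -> phi z \in porbit s x.
  have := pair_orb z; rewrite porbit_sym -!eq_porbit_mem => /eqP->.
  by rewrite eq_sym.
move=> a fa; apply: contraT => aO.
have faO : phi a \notin porbit s x.
  by apply: contraNN aO => /pair_mem; rewrite phiK.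
(* A third point of [O]; its pair differs from [x, phi x]. *)
set b := s (phi x).
have fb : phi b != b by rewrite /b sfxE.
have bO : b \in porbit s x by rewrite porbit_step porbit_sym.
have fbO := pair_mem _ bO.
have bfx : b != phi x by rewrite -sx (inj_eq perm_inj).
have fbx : phi b != x by apply: contraNneq bfx => <-; rewrite phiK.
have ne_aO z : z \in porbit s x -> (a != z) * (phi a != z).
  move=> zO; split; first by apply: contraNneq aO => ->.
  by apply: contraNneq faO => ->.
(* [s1] splits the orbit of [a]; [s2] merges the part containing [a] with [O]. *)
pose s1 := tperm a (phi a) * s; pose s2 := tperm b a * s1.
have O1 z : z \in porbit s x -> s1 z \in porbit s x.
  by move=> zO; rewrite permM tpermD ?ne_aO // porbit_step.
have n1 : #|porbits s1| = #|porbits s|.+1.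
  by apply: porbits_split; rewrite // eq_sym.
have n1' : a \notin porbit s1 (phi a).
  apply/negP=> /porbits_split; rewrite /s1 mulgA tperm2 mul1g -/s1 n1 eq_sym fa.
  by move=> /(_ isT)/eqP; rewrite ltn_eqF // ltnS leqnSn.
(* The two merges are genuine because the part containing [phi a] is disjoint
   from the union of [O] with the part containing [a]. *)
have m2 : b \notin porbit s1 a.
  rewrite porbit_sym; apply: contraNN aO.
  by apply/subsetP/porbit_sub_closed.
have m3 : phi b \notin porbit s2 (phi a).
  rewrite porbit_sym.
  have /subsetP/(_ (phi a)) :
      porbit s2 (phi b) \subset porbit s x :|: porbit s1 a.
    apply: porbit_sub_closed => [|z]; first by rewrite inE fbO.
    rewrite !inE permM; case: tpermP => [-> _|-> _|_ _ /orP[/O1->|]] //.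
    - by rewrite porbit_step porbit_id orbT.
    - by rewrite O1.
    by rewrite porbit_step orbC => ->.
  move=> /contraNN; apply.
  by rewrite inE negb_or faO porbit_sym.
have := min_s (tperm (phi b) (phi a) * tperm b a * tperm a (phi a)).
rewrite -!mulgA -/s1 -/s2; move: n1.
rewrite (porbits_merge m2) (porbits_merge m3) -/s2 => -[<-].
rewrite ltnn; apply.
  rewrite mulgA groupM ?tperm_pair_cent ?tperm_swap_cent //.
    by rewrite ne_aO.
  by rewrite ne_aO.
rewrite 2!permM [tperm _ _ x]tpermD ?ne_aO ?porbit_id //.
by rewrite !tpermD ?ne_aO ?porbit_id // eq_sym.
Qed.

Hypothesis phi_fix : forall x y, phi x = x -> phi y = y -> x = y.

(** A moved point [x] and its partner lie in the same cycle, half a turn apart;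
    an even permutation has a cycle of odd length, where this is impossible. *)
Lemma even_cent_not_cycle s :
  s \in 'C[phi] -> ~~ odd_perm s -> ~ is_cycle s.
Proof.
move=> cs es [x [sx orb]]; have oL := odd_cycle_length sx orb es.
have sE := cent_permE cs.
have fx : phi x != x.
  by apply: contraNneq sx => fx; apply/eqP/phi_fix; rewrite // -sE fx.
have /orb/porbitP[i fxE] : s (phi x) != phi x by rewrite sE (inj_eq perm_inj).
have sL : (s ^+ #|porbit s x|) x = x by rewrite permX iter_porbit.
have sLn n : (s ^+ (#|porbit s x| * n)) x = x.
  by elim: n => [|n IHn]; rewrite ?muln0 ?perm1 // mulnS expgD permM sL.
have s2i : (s ^+ (i * 2)) x = x.
  rewrite muln2 -addnn expgD permM -fxE cent_permE ?groupX //.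
  by rewrite -fxE phiK.
have s2in n : (s ^+ (i * 2 * n)) x = x.
  by elim: n => [|n IHn]; rewrite ?muln0 ?perm1 // mulnS expgD permM s2i.
(* With [L] the odd length, [s^i x = s^((L + 1) i) x], and [(L + 1) i] is a
   multiple of [2 i]. *)
case/eqP: fx; rewrite fxE -[in LHS](sLn i) -permM -expgD -mulSnr.
rewrite -[_.+1]odd_double_half /= oL add0n -muln2 mulnC.
by rewrite (mulnC _ 2) mulnA s2in.
Qed.

Section PairStart.
Variables (oo : T) (t : {perm T}).
Hypothesis phi_oo : phi oo = oo.

(** The conjugate [phi ^ t] pairs the points as [t] maps the [phi]-pairs, and its
    fixed point is [w = t oo]. If no [z] as below exists, then [phi ^ t] and [phi]
    agree except on [oo], [w] and [(phi ^ t) oo]; this forces [(phi ^ t) oo] to be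
    [phi w], so that [phi ^ t] is the conjugate of [phi] under the transposition
    of [w] and [oo]. *)
Lemma pair_start :
  t * tperm (t oo) oo \notin 'C[phi] ->
  exists z, [/\ phi z != z, (phi ^ t) z != z, (phi ^ t) z != phi z
   & phi ((phi ^ t) z) != (phi ^ t) z].
Proof.
set psi := phi ^ t; set w := t oo => ncu.
have phi_fixE z : (phi z == z) = (z == oo).
  by apply/eqP/eqP=> [/phi_fix/(_ phi_oo)|->].
have psiE z : psi (t z) = t (phi z) by rewrite permJ.
have psiK : involutive psi by move=> z; rewrite -[z](permKV t) !psiE phiK.
have psi_fixE z : (psi z == z) = (z == w).
  by rewrite -[z](permKV t) psiE !(inj_eq perm_inj) phi_fixE.
suff /existsP[z /and4P[]] : [exists z, [&& phi z != z, psi z != z,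
  psi z != phi z & phi (psi z) != psi z]] by exists z.
apply: contraNT ncu => /existsPn no_z.
have eq_psi z : z != oo -> z != w -> psi z != oo -> psi z = phi z.
  move=> zoo zw pzoo; have := no_z z.
  by rewrite !phi_fixE psi_fixE zoo zw pzoo andbT negbK => /eqP.
have psi_w : psi w = w by apply/eqP; rewrite psi_fixE.
suff psiT : psi = phi ^ tperm w oo.
  rewrite cent1C; apply/cent1P/commgP/conjg_fixP.
  by rewrite conjgM -/psi psiT -conjgM tperm2 conjg1.
have psi_oo : psi oo = phi w.
  have [woo | woo] := eqVneq w oo; first by rewrite -{1}woo psi_w woo phi_oo.
  have fwoo : phi w != oo.
    by apply: contraNneq woo => fw; rewrite -(phiK w) fw phi_oo.
  have fw : phi w != w by rewrite phi_fixE.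
  apply: contraNeq fw => neq; rewrite -(inj_eq (can_inj psiK)) psi_w.
  rewrite eq_psi ?phiK ?phi_fixE //.
  by apply: contraNneq neq => <-; rewrite psiK.
clearbody psi; apply/permP=> z; rewrite conjgE !permM tpermV.
have [-> | zw] := eqVneq z w; first by rewrite tpermL phi_oo tpermR psi_w.
have [-> | zoo] := eqVneq z oo.
  rewrite tpermR psi_oo; have [-> | woo] := eqVneq w oo.
    by rewrite tperm1 perm1.
  rewrite tpermD // 1?eq_sym ?phi_fixE //.
  by apply: contraNneq woo => fw; rewrite -(phiK w) fw phi_oo.
rewrite [tperm w oo z]tpermD 1?eq_sym //.
have [pz | pz] := eqVneq (psi z) oo.
  by rewrite -[z in phi z]psiK pz psi_oo phiK tpermL.
rewrite eq_psi // tpermD // eq_sym.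
  by apply: contraNneq pz => fz; rewrite -(phiK z) fz -psi_oo psiK.
by apply: contraNneq zoo => fz; rewrite -(phiK z) fz phi_oo.
Qed.
End PairStart.

(** Every coset of the even part of ['C[phi]], apart from that subgroup itself,
    contains a single cycle. *)
Lemma coset_cycle oo x0 t : phi oo = oo -> phi x0 != x0 ->
    ~~ ((t \in 'C[phi]) && ~~ odd_perm t) ->
  exists g, [/\ g \in 'C[phi], ~~ odd_perm g & is_cycle (g * t)].
Proof.
move=> foo fx0 nGt; set w := t oo.
have phi_fixE z : (phi z == z) = (z == oo).
  by apply/eqP/eqP=> [/phi_fix/(_ foo)|->].
have [cu|ncu] := boolP (t * tperm w oo \in 'C[phi]).
  (* Here [g * t] is the transposition of [w] and [oo], or [1] when [w = oo]; if
     [g] is odd, the parity is repaired by the transposition of one pair. *)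
  pose g := (t * tperm w oo)^-1.
  have cg : g \in 'C[phi] by rewrite groupV.
  have gt : g * t = tperm w oo by rewrite /g invMg tpermV mulgKV.
  have odd_g : odd_perm g = (w != oo) (+) odd_perm t.
    by rewrite odd_permV odd_permM odd_tperm addbC.
  have [woo|woo] := eqVneq w oo.
    move: nGt cu odd_g; rewrite woo tperm1 mulg1 eqxx addFb => + ct.
    rewrite ct negbK => odd_t odd_g.
    exists (tperm x0 (phi x0) * g); rewrite groupM ?tperm_pair_cent //.
    rewrite odd_permM odd_tperm eq_sym fx0 odd_g odd_t.
    rewrite -mulgA gt woo tperm1 mulg1.
    by split=> //; apply: is_cycle_tperm; rewrite eq_sym.
  have [odd_gT|] := boolP (odd_perm g); last first.
    by exists g; rewrite gt; split=> //; apply: is_cycle_tperm.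
  have fw : phi w != w by rewrite phi_fixE.
  exists (tperm w (phi w) * g); rewrite groupM ?tperm_pair_cent //.
  rewrite odd_permM odd_tperm eq_sym fw odd_gT -mulgA gt; split=> //.
  apply: is_cycle_tperm2; rewrite // 1?eq_sym //.
  by apply: contraNneq woo => fwoo; rewrite -(phiK w) -fwoo foo.
have [z [fz pz pfz fpz]] := pair_start foo ncu.
set psi := phi ^ t in pz pfz fpz.
have psiE y : psi (t y) = t (phi y) by rewrite permJ.
(* The point [x] is chosen so that the next two steps can make its image [z]. *)
pose x := phi z; have fx : phi x != x by rewrite phiK eq_sym.
have fa : phi (t^-1 z) != t^-1 z.
  by rewrite -(inj_eq (@perm_inj _ t)) -psiE permKV.
have [g0 cg0 g0x] := cent_perm_trans fx fa.
have s0x : (g0 * t) x = z by rewrite permM g0x permKV.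
have s0fx : (g0 * t) z = psi z.
  by rewrite -[in LHS](phiK z) permM cent_permE // g0x -psiE permKV.
have [||||g1 cg1 [sx sfx orb]] := @exists_big_orbit (g0 * t) x.
- by rewrite s0x phiK.
- by [].
- by rewrite phiK s0fx.
- by rewrite phiK s0fx.
rewrite mulgA in sx sfx orb; set g := g1 * g0 in sx sfx orb.
have cg : g \in 'C[phi] by rewrite groupM.
set s := g * t in sx sfx orb.
(* If [s] moves [oo], then [s oo] belongs to a pair, hence to the big orbit. *)
have {}orb y : s y != y -> y \in porbit s x.
  move=> sy; have [|fy] := boolP (phi y != y); first exact: orb.
  rewrite -porbit_step; apply: orb; move: fy sy; rewrite negbK !phi_fixE.
  by move/eqP->.
have [odd_g|even_g] := boolP (odd_perm g); last first.
  by exists g; split=> //; exists x; rewrite sx.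
exists (tperm x (phi x) * g); rewrite groupM ?tperm_pair_cent //.
rewrite odd_permM odd_tperm eq_sym fx odd_g -mulgA; split=> //.
by apply: is_cycle_mul_tperm; rewrite // eq_sym.
Qed.
End Involution.
End Orbits.

(** * The group G as an even centraliser *)

Section Pairs.
Variable k : nat.
Implicit Types (x : 'I_(k + k)) (i : 'I_k) (p : 'S_k) (d : 'rV[bool]_k).

Definition pair_of x : 'I_k := match split x with inl i => i | inr i => i end.

Definition partner x : 'I_(k + k) :=
  match split x with inl i => rshift k i | inr i => lshift k i end.

Lemma split_lshift i : split (lshift k i) = inl i :> 'I_k + 'I_k.
Proof. exact: (unsplitK (inl i)). Qed.

Lemma split_rshift i : split (rshift k i) = inr i :> 'I_k + 'I_k.
Proof. exact: (unsplitK (inr i)). Qed.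

Definition splitE := (split_lshift, split_rshift).

Lemma partnerK : involutive partner.
Proof. by move=> x; case: (split_ordP x) => i ->; rewrite /partner !splitE. Qed.

Lemma partner_neq x : partner x != x.
Proof.
case: (split_ordP x) => i ->.
all: by rewrite /partner splitE (eq_lrshift, eq_rlshift).
Qed.

Lemma pair_of_partner x : pair_of (partner x) = pair_of x.
Proof.
by case: (split_ordP x) => i ->; rewrite /partner /pair_of !splitE.
Qed.

Lemma pair_of_eq x y : pair_of x = pair_of y -> x = y \/ x = partner y.
Proof.
case: (split_ordP x) => i ->; case: (split_ordP y) => j ->.
all: by rewrite /pair_of /partner !splitE => ->; auto.
Qed.

Definition swap : 'S_(k + k) := perm (inv_inj partnerK).

Lemma swapE x : swap x = partner x. Proof. exact: permE. Qed.

Definition double_fun p x : 'I_(k + k) :=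
  match split x with inl i => lshift k (p i) | inr i => rshift k (p i) end.

Lemma double_fun_inj p : injective (double_fun p).
Proof.
apply: can_inj (double_fun p^-1) _ => x.
by case: (split_ordP x) => i ->; rewrite /double_fun !splitE permK.
Qed.

Definition double p : 'S_(k + k) := perm (@double_fun_inj p).

Definition flip_fun d x := if d 0%R (pair_of x) then partner x else x.

Lemma flip_funK d : involutive (flip_fun d).
Proof.
move=> x; rewrite /flip_fun.
by case dx: (d 0%R (pair_of x)); rewrite ?pair_of_partner dx ?partnerK.
Qed.

Definition flip d : 'S_(k + k) := perm (inv_inj (flip_funK d)).

Lemma double_cent p : double p \in 'C[swap].
Proof.
apply/cent1P/permP=> x; rewrite !permM !permE.
by case: (split_ordP x) => i ->; rewrite /partner /double_fun !splitE.
Qed.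

Lemma flip_cent d : flip d \in 'C[swap].
Proof.
apply/cent1P/permP=> x; rewrite !permM !permE /flip_fun pair_of_partner.
by case: ifP.
Qed.

(** [s] induces a permutation [p] of the pairs; what remains after [double p] is
    to exchange the two points of certain pairs. *)
Lemma cent_swapP s : s \in 'C[swap] -> exists p d, s = double p * flip d.
Proof.
move/cent1P=> cs.
have sP x : s (partner x) = partner (s x) by rewrite -!swapE -!permM cs.
have p_inj : injective (fun i => pair_of (s (lshift k i))).
  move=> i j /pair_of_eq[/perm_inj/lshift_inj // | ].
  rewrite -sP => /perm_inj/eqP.
  by rewrite /partner splitE eq_lrshift.
pose p := perm p_inj.
pose d := (\row_j (s (lshift k (p^-1%g j)) == rshift k j))%R : 'rV[bool]_k.
exists p, d; apply/permP=> x.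
(* Both sides commute with [swap], so one point of each pair is enough. *)
wlog [i ->] : x / exists i, x = lshift k i.
  move=> IH; case: (split_ordP x) => i ->; first by apply: IH; exists i.
  have -> : rshift k i = partner (lshift k i) by rewrite /partner splitE.
  rewrite sP IH; last by exists i.
  have /cent1P := groupM (double_cent p) (flip_cent d).
  by rewrite -!swapE -!permM => ->.
rewrite permM [double p _]permE /double_fun splitE permE /flip_fun.
have -> : pair_of (lshift k (p i)) = p i by rewrite /pair_of splitE.
rewrite mxE permK permE /pair_of /partner.
by case: (split_ordP (s _)) => j ->; rewrite !splitE ?eqxx ?eq_lrshift.
Qed.

Local Open Scope ring_scope.

Lemma perm_mx_double p :
  perm_mx (double p) = block_mx (perm_mx p) 0 0 (perm_mx p) :> 'M[int]_(k + k).
Proof.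
apply/matrixP=> x y; case: (split_ordP x) => i ->; case: (split_ordP y) => j ->.
all: rewrite ?(block_mxEul, block_mxEur, block_mxEdl, block_mxEdr) !mxE permE.
all: rewrite /double_fun splitE.
all: by rewrite ?(eq_lshift, eq_rshift, eq_lrshift, eq_rlshift).
Qed.

Lemma perm_mx_flip d :
  perm_mx (flip d) =
  block_mx (1%:M - diag01 d) (diag01 d) (diag01 d) (1%:M - diag01 d).
Proof.
apply/matrixP=> x y; case: (split_ordP x) => i ->; case: (split_ordP y) => j ->.
all: rewrite ?(block_mxEul, block_mxEur, block_mxEdl, block_mxEdr) !mxE permE.
all: rewrite /flip_fun /pair_of /partner !splitE.
all: case: (d 0%R i); rewrite ?(eq_lshift, eq_rshift, eq_lrshift, eq_rlshift).
all: by case: (i == j).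
Qed.

Lemma perm_mx_int_inj n : injective (fun s : 'S_n => perm_mx s : 'M[int]_n).
Proof.
move=> s t eq_st; apply/permP=> i.
have /matrixP/(_ i (s i)) := eq_st; rewrite !mxE eqxx.
by case: eqP.
Qed.

Lemma odd_double p : odd_perm (double p) = false.
Proof.
have := det_perm int (double p); rewrite perm_mx_double det_ublock !det_perm.
by case: (odd_perm p); case: (odd_perm _).
Qed.

(** Block elimination turns the matrix of [flip d] into a block triangular one
    with diagonal blocks [1] and [1 - 2 D], where [D] is the 0-1 matrix of [d];
    the determinant is thus [(-1)] to the trace of [D]. *)
Lemma odd_flip d : odd_perm (flip d) = odd (\sum_i d 0%R i).
Proof.
set D := diag01 d.
have detE : \det (perm_mx (flip d) : 'M[int]_(k + k)) = \det (1%:M - D - D).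
  have clear_r : perm_mx (flip d) *m block_mx 1%:M 0 1%:M 1%:M
      = block_mx 1%:M D 1%:M (1%:M - D).
    rewrite perm_mx_flip mulmx_block !mulmx1 !mulmx0 !add0r subrK.
    by rewrite addrC subrK.
  have clear_l : block_mx 1%:M 0 (- 1%:M) 1%:M *m
        (block_mx 1%:M D 1%:M (1%:M - D))
      = block_mx 1%:M D 0 (1%:M - D - D).
    rewrite mulmx_block !mul1mx !mul0mx !addr0 mulNmx mul1mx mulNmx mul1mx addNr.
    by rewrite addrC.
  have := congr1 determinant clear_l; rewrite -clear_r !det_mulmx.
  by rewrite !det_lblock det_ublock !det1 !mul1r !mulr1.
move: detE; rewrite det_perm.
have -> : 1%:M - D - D = diag_mx (\row_i (-1) ^+ d 0%R i).
  apply/matrixP=> i j; rewrite !mxE; case: (i == j); rewrite ?mulr1n ?mulr0n //.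
  by case: (d 0%R i).
rewrite det_diag (eq_bigr (fun i => (-1) ^+ d 0%R i)) => [|i _]; last first.
  by rewrite mxE.
rewrite prodrXr -[(-1) ^+ (\sum_i _)]signr_odd.
by case: (odd_perm _); case: (odd _).
Qed.

Lemma even_tr_diag01 d : (2 %| \tr (diag01 d))%Z = ~~ odd (\sum_i d 0%R i).
Proof.
have -> : \tr (diag01 d) = (\sum_i d 0%R i)%N%:R.
  rewrite /diag01 mxtrace_diag natr_sum; apply: eq_bigr => i _.
  by rewrite mxE.
by rewrite natz dvdzE /= dvdn2.
Qed.

Lemma mem_Ggrp s : (s \in Ggrp k) = (s \in 'C[swap]) && ~~ odd_perm s.
Proof.
apply/mulsgP/andP=> [[h q]|[/cent_swapP[p [d ->]]]].
  rewrite [h \in _]inE [q \in _]inE.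
  move=> /existsP[p /eqP sp] /existsP[d /andP[ev /eqP sq]] ->.
  have -> : h = double p by apply: perm_mx_int_inj; rewrite perm_mx_double.
  have -> : q = flip d by apply: perm_mx_int_inj; rewrite perm_mx_flip.
  rewrite groupM ?double_cent ?flip_cent // odd_permM odd_double odd_flip.
  by rewrite even_tr_diag01 in ev.
rewrite odd_permM odd_double odd_flip => ev; exists (double p) (flip d) => //.
  by rewrite inE; apply/existsP; exists p; rewrite perm_mx_double.
rewrite inE; apply/existsP; exists d.
by rewrite even_tr_diag01 ev perm_mx_flip eqxx.
Qed.
End Pairs.

(** * Adding a fixed last point *)

Section FixLast.
Variable m : nat.

Lemma fix_lastM (s t : 'S_m) : fix_last (s * t) = fix_last s * fix_last t.
Proof. by rewrite /fix_last lift_permM. Qed.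

Lemma odd_fix_last (s : 'S_m) : odd_perm (fix_last s) = odd_perm s.
Proof. by rewrite odd_lift_perm addbb. Qed.

Lemma fix_last_inj : injective (@fix_last m).
Proof.
move=> s t eq_st; apply/permP=> i; apply: (@lift_inj _ ord_max).
by rewrite -!(lift_perm_lift ord_max ord_max) -/(fix_last s) eq_st.
Qed.

Lemma fix_lastP (t : 'S_m.+1) : t ord_max = ord_max -> exists s, t = fix_last s.
Proof.
move=> tmax.
have t_lift i : {j | t (lift ord_max i) = lift ord_max j}.
  case: (unliftP ord_max (t (lift ord_max i))) => [j ->|]; first by exists j.
  by rewrite -{2}tmax => /perm_inj/eqP; rewrite eq_sym (negPf (neq_lift _ _)).
have f_inj : injective (fun i => sval (t_lift i)).
  move=> i j eq_ij; apply/(@lift_inj _ ord_max)/(@perm_inj _ t).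
  rewrite [LHS](svalP (t_lift i)) [RHS](svalP (t_lift j)).
  by congr lift; apply: eq_ij.
exists (perm f_inj); apply/permP=> x; case: (unliftP ord_max x) => [i ->|->].
  by rewrite lift_perm_lift permE; apply: svalP (t_lift i).
by rewrite lift_perm_id tmax.
Qed.
End FixLast.

Section Pairing.
Variable k : nat.
Let phi := fix_last (swap k).

Lemma pairing_last : phi ord_max = ord_max.
Proof. exact: lift_perm_id. Qed.

Lemma pairing_lift x : phi (lift ord_max x) = lift ord_max (partner x).
Proof. by rewrite /phi /fix_last lift_perm_lift swapE. Qed.

Lemma pairingK : involutive phi.
Proof.
move=> x; case: (unliftP ord_max x) => [i ->|->].
  by rewrite !pairing_lift partnerK.
by rewrite !pairing_last.
Qed.

Lemma pairing_lift_neq x : phi (lift ord_max x) != lift ord_max x.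
Proof. by rewrite pairing_lift (inj_eq (@lift_inj _ _)) partner_neq. Qed.

Lemma pairing_fix_uniq x y : phi x = x -> phi y = y -> x = y.
Proof.
have fixE z : phi z = z -> z = ord_max.
  case: (unliftP ord_max z) => [i ->|-> //].
  by move/eqP; rewrite (negPf (pairing_lift_neq i)).
by move=> /fixE-> /fixE->.
Qed.

(** Commuting with [phi] forces the last point, as the only fixed point of
    [phi], to be fixed as well. *)
Lemma mem_fix_last_Ggrp t :
  (t \in [set fix_last s | s in Ggrp k]) = (t \in 'C[phi]) && ~~ odd_perm t.
Proof.
apply/imsetP/andP=> [[s + ->]|[ct et]].
  rewrite mem_Ggrp odd_fix_last => /andP[/cent1P cs ->]; split=> //.
  by apply/cent1P; rewrite /commute -!fix_lastM cs.
have tmax : t ord_max = ord_max.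
  apply: pairing_fix_uniq pairing_last.
  by rewrite -(cent_permE ct) pairing_last.
have [s def_t] := fix_lastP tmax; exists s => //.
rewrite mem_Ggrp -odd_fix_last -def_t et andbT; apply/cent1P/fix_last_inj.
by rewrite !fix_lastM -def_t; apply/cent1P.
Qed.
End Pairing.

(** * Maximal independence *)

Lemma single_cycleP m (s : 'S_m) : reflect (is_cycle s) (single_cycle s).
Proof.
apply: (iffP cards1P) => [[C defC]|[x [sx orb]]]; last first.
  by exists (porbit s x); apply: porbits_cycle.
have memC D : (D \in porbits s) && (1 < #|D|) = (D == C).
  by have := congr1 (fun A : {set {set 'I_m}} => D \in A) defC; rewrite !inE.
have := eqxx C; rewrite -memC => /andP[/imsetP[x _ defx]].
rewrite defx porbit_gt1 => sx; exists x; split=> // y sy.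
by rewrite porbit_sym -eq_porbit_mem -defx eq_sym -memC imset_f // porbit_gt1.
Qed.

Theorem theorem3p6 (k : nat) (n_ge4 : 4 <= k + k) :
  let G : {set 'S_((k + k).+1)} := [set fix_last s | s in Ggrp k] in
  independent G /\
  (forall t : 'S_((k + k).+1), t \notin G -> ~~ independent (t |: G)).
Proof.
move=> G; set phi := fix_last (swap k).
have memG t : (t \in G) = (t \in 'C[phi]) && ~~ odd_perm t.
  exact: mem_fix_last_Ggrp.
split=> [|t nGt].
  apply/'forall_in_'forall_in_implyP=> s1 + s2; rewrite !memG.
  move=> /andP[c1 e1] /andP[c2 e2] _; apply/single_cycleP.
  apply: (even_cent_not_cycle (pairingK (k := k))).
  - exact: pairing_fix_uniq.
  - by rewrite groupM ?groupV.
  by rewrite odd_permM odd_permV (negPf e1) (negPf e2).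
have k_gt0 : 0 < k + k by apply: leq_trans n_ge4.
have [g [cg eg cyc]] := coset_cycle (pairingK (k := k))
  (@pairing_fix_uniq k) (pairing_last k)
  (pairing_lift_neq (Ordinal k_gt0)) (etrans (congr1 negb (esym (memG t))) nGt).
apply/negP=> /'forall_in_'forall_in_implyP indep.
have Gg : g^-1 \in G by rewrite memG groupV cg odd_permV.
have /negP[] : ~~ birkhoff_adj g^-1 t.
  apply: indep; rewrite ?setU11 ?setU1r //.
  by apply: contraNneq nGt => <-.
by rewrite /birkhoff_adj invgK; apply/single_cycleP.
Qed.
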